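(* For a word $u$ of length $n$, the seed array $\mathsf{Seed}[1..n]$, where $\mathsf{Seed}[i]$ is the length of the shortest seed of the prefix $u[1..i]$, can be computed in $O(n^2)$ time.
   Context: Words are over a finite alphabet. A word $s$ covers $w$ if every position of $w$ lies in some occurrence of $s$ as a factor of $w$. A seed of a word $x$ is a factor $s$ of $x$ such that $x$ is a factor of some word covered by $s$. *)

(* Defs.v *)
From mathcomp Require Import all_boot.
Set Implicit Arguments. Unset Strict Implicit. Unset Printing Implicit Defensive.

Section Words.
Variable T : eqType.

Definition occurs_at (s w : seq T) (i : nat) : bool :=
  (i + size s <= size w) && (take (size s) (drop i w) == s).

Definition covers (s w : seq T) : Prop :=
  forall j, j < size w -> exists i, occurs_at s w i && (i <= j < i + size s).

Definition seed (s x : seq T) : Prop :=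
  infix s x /\ exists w : seq T, covers s w /\ infix x w.

Definition shortest_seed_length (x : seq T) (m : nat) : Prop :=
  (exists s, seed s x /\ size s = m) /\ (forall s, seed s x -> m <= size s).

End Words.

Inductive instr : Type :=
| IConst (r k : nat)
| IAdd (r a b : nat)
| ISub (r a b : nat)        (* R[r] := R[a] - R[b] (truncated)        *)
| IMul (r a b : nat)
| IDiv (r a b : nat)        (* R[r] := R[a] %/ R[b]  (x %/ 0 = 0)     *)
| IMod (r a b : nat)        (* R[r] := R[a] %% R[b]  (x %% 0 = x)     *)
| ILoad (r a : nat)
| IStore (a r : nat)
| IJlt (a b l : nat)
| IJmp (l : nat)
| IHalt.

Definition program := seq instr.

Record config := Config { cpc : nat; cregs : nat -> nat; cmem : nat -> nat }.

Definition upd (f : nat -> nat) (x v : nat) : nat -> nat :=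
  fun y => if y == x then v else f y.

(* One step; None when the machine has halted (IHalt or cpc out of range). *)
Definition step (p : program) (c : config) : option config :=
  let R := cregs c in let M := cmem c in let k := cpc c in
  match nth IHalt p k with
  | IConst r v => Some (Config k.+1 (upd R r v) M)
  | IAdd r a b => Some (Config k.+1 (upd R r (R a + R b)) M)
  | ISub r a b => Some (Config k.+1 (upd R r (R a - R b)) M)
  | IMul r a b => Some (Config k.+1 (upd R r (R a * R b)) M)
  | IDiv r a b => Some (Config k.+1 (upd R r (R a %/ R b)) M)
  | IMod r a b => Some (Config k.+1 (upd R r (R a %% R b)) M)
  | ILoad r a => Some (Config k.+1 (upd R r (M (R a))) M)
  | IStore a r => Some (Config k.+1 R (upd M (R a) (R r)))
  | IJlt a b l => Some (Config (if R a < R b then l else k.+1) R M)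
  | IJmp l => Some (Config l R M)
  | IHalt => None
  end.

Fixpoint exec (p : program) (t : nat) (c : config) : option config :=
  match step p c with
  | None => Some c
  | Some c' => if t is t'.+1 then exec p t' c' else None
  end.

Definition bounded (B : nat) (c : config) : Prop :=
  (forall r, cregs c r <= B) /\ (forall a, cmem c a <= B).

(* all configurations visited during the first t steps are B-bounded
   (word size O(log n)) *)
Fixpoint run_bounded (p : program) (t : nat) (B : nat) (c : config) : Prop :=
  bounded B c /\
  match step p c with
  | None => True
  | Some c' => if t is t'.+1 then run_bounded p t' B c' else True
  end.

Definition init_config (sigma : nat) (u : seq 'I_sigma) : config :=
  Config 0 (fun _ => 0)
    (fun a => if a == 0 then size u
              else if a <= size u then nth 0 (map val u) a.-1
              else 0).

(* Main.v *)
Require Import Defs.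
From mathcomp Require Import all_boot.
From mathcomp Require Import zify.
Set Implicit Arguments. Unset Strict Implicit. Unset Printing Implicit Defensive.

(* Let [ell a b] be the longest common prefix of the suffixes of u at a and b,
   and [reach p k] the end of the longest factor starting at p with a period at
   most k.  A factor s = u[p..p+k) is a seed of u[0..i), p + k <= i, as soon as
   i <= reach p k and p is good for k: u[0..p+k) is covered by occurrences of s,
   possibly overhanging on the left.  Goodness follows the chain of previous
   occurrences: p is good iff p + k <= reach 0 k or the previous occurrence of s
   is good and at distance at most k.  Conversely, the last occurrence of a seed
   is such a p.  Since the seed array is nondecreasing, Seed[i] is the least k
   for which some p good for some k' <= k has i <= reach p k'.  Each of the
   tables involved is filled by two nested loops of length n. *)

(** * A loop language compiled to the word RAM *)

(** Being a seed of u[0..i) involves three parameters p, k and i. Goodness does not mention i, and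
    the condition on the right is a threshold on i, so for each k one number, the largest reach of a
    good position, settles all i at once. The price is that the requirement p + k <= i is lost, and
    showing this harmless is where monotonicity has to be proved rather than assumed. The loop
    language separates concerns: step count and word size follow from the syntax of a program (the
    degree in n is the nesting depth), so only the computed values need verification. *)

(* [Var 0] is the input length n, and [Var d] the counter of the enclosing loop
   at depth d.  The compiled code keeps [Var d] in register d and uses the
   registers above the current depth as scratch. *)
Inductive expr :=
| Var (r : nat) | Cst (k : nat)
| Plus (a b : expr) | Minus (a b : expr) | Times (a b : expr)
| Read (a : expr).

(* [Loop c] runs [c] for the counter values 0, ..., n - 1.  [Put] truncates the
   stored value at n, which bounds all intermediate values by a polynomial in n
   for every program. *)
Inductive com :=
| Put (a e : expr)
| When (a b : expr) (c : com)
| Seq (c c' : com)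
| Loop (c : com).

Fixpoint eval (E m : nat -> nat) (e : expr) : nat :=
  match e with
  | Var r => E r
  | Cst k => k
  | Plus a b => eval E m a + eval E m b
  | Minus a b => eval E m a - eval E m b
  | Times a b => eval E m a * eval E m b
  | Read a => m (eval E m a)
  end.

Fixpoint sem (d : nat) (c : com) (E m : nat -> nat) : nat -> nat :=
  match c with
  | Put a e => upd m (eval E m a) (minn (eval E m e) (E 0))
  | When a b c => if eval E m a < eval E m b then sem d c E m else m
  | Seq c c' => sem d c' E (sem d c E m)
  | Loop c => foldl (fun m j => sem d.+1 c (upd E d.+1 j) m) m (iota 0 (E 0))
  end.

Fixpoint ewf (d : nat) (e : expr) : bool :=
  match e with
  | Var r => r <= d
  | Cst _ => true
  | Plus a b | Minus a b | Times a b => ewf d a && ewf d b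
  | Read a => ewf d a
  end.

Fixpoint wf (d : nat) (c : com) : bool :=
  match c with
  | Put a e => ewf d a && ewf d e
  | When a b c => [&& ewf d a, ewf d b & wf d c]
  | Seq c c' => wf d c && wf d c'
  | Loop c => wf d.+1 c
  end.

(** Registers serve as a stack with top t: the value goes to t, and the registers above are scratch.
    Copying a register is adding it to 0. *)
Fixpoint cexp (t : nat) (e : expr) : program :=
  match e with
  | Var r => [:: IConst t 0; IAdd t t r]
  | Cst k => [:: IConst t k]
  | Plus a b => cexp t a ++ cexp t.+1 b ++ [:: IAdd t t t.+1]
  | Minus a b => cexp t a ++ cexp t.+1 b ++ [:: ISub t t t.+1]
  | Times a b => cexp t a ++ cexp t.+1 b ++ [:: IMul t t t.+1]
  | Read a => cexp t a ++ [:: ILoad t t]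
  end.

(** Jumps are absolute, so k is the address of the code. In [Put], the minimum of v and n is
    obtained as v - (v - n). *)
Fixpoint ccom (d k : nat) (c : com) : program :=
  match c with
  | Put a e =>
      cexp d.+1 a ++ cexp d.+2 e ++
      [:: ISub d.+3 d.+2 0; ISub d.+2 d.+2 d.+3; IStore d.+1 d.+2]
  | When a b c =>
      let k1 := k + size (cexp d.+1 a) + size (cexp d.+2 b) in
      let body := ccom d k1.+2 c in
      cexp d.+1 a ++ cexp d.+2 b ++
      [:: IJlt d.+1 d.+2 k1.+2; IJmp (k1.+2 + size body)] ++ body
  | Seq c c' =>
      let code := ccom d k c in code ++ ccom d (k + size code) c'
  | Loop c =>
      let body := ccom d.+1 (k + 3) c in
      [:: IConst d.+1 0; IJlt d.+1 0 (k + 3); IJmp (k + 6 + size body)] ++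
      body ++ [:: IConst d.+2 1; IAdd d.+1 d.+1 d.+2; IJmp k.+1]
  end.

Fixpoint cost (d : nat) (c : com) (n : nat) : nat :=
  match c with
  | Put a e => size (cexp d.+1 a) + size (cexp d.+2 e) + 3
  | When a b c => size (cexp d.+1 a) + size (cexp d.+2 b) + 2 + cost d c n
  | Seq c c' => cost d c n + cost d c' n
  | Loop c => 3 + n * (cost d.+1 c n + 4)
  end.

(** Bounds all intermediate values and addresses as well as the result: hence the sum for [Minus],
    and the successors for [Times], where one operand may be 0. *)
Fixpoint ebound (X : nat) (e : expr) : nat :=
  match e with
  | Var _ => X
  | Cst k => k
  | Plus a b | Minus a b => ebound X a + ebound X b
  | Times a b => (ebound X a).+1 * (ebound X b).+1
  | Read a => ebound X a + X
  end.

Fixpoint cbound (X : nat) (c : com) : nat :=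
  match c with
  | Put a e => ebound X a + ebound X e
  | When a b c => ebound X a + ebound X b + cbound X c
  | Seq c c' => cbound X c + cbound X c'
  | Loop c => X + 1 + cbound X c
  end.

Lemma eval_bound d E m X e :
    (forall r, r <= d -> E r <= X) -> (forall a, m a <= X) -> ewf d e ->
  eval E m e <= ebound X e.
Proof.
move=> EX mX; elim: e => [r|k|a IHa b IHb|a IHa b IHb|a IHa b IHb|a IHa] //=.
- exact: EX.
- by case/andP=> /IHa ha /IHb hb; apply: leq_add.
- by case/andP=> /IHa ha /IHb hb; lia.
- by case/andP=> /IHa ha /IHb hb; apply: leq_mul; apply: leqW.
- by move=> _; apply: leq_trans (mX _) (leq_addl _ _).
Qed.

(** * Correctness of the compiler *)

Section Exec.
Variables (p : program) (B : nat).

Fixpoint runs (t : nat) (c c' : config) : Prop :=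
  if t is t'.+1 then
    bounded B c /\ exists2 c1, step p c = Some c1 & runs t' c1 c'
  else c = c'.

Lemma runs_trans t1 t2 c1 c2 c3 :
  runs t1 c1 c2 -> runs t2 c2 c3 -> runs (t1 + t2) c1 c3.
Proof.
elim: t1 c1 => [|t1 IH] c1 /=; first by move=> ->.
by case=> bc [c sc r1] r2; split=> //; exists c => //; apply: IH.
Qed.

Lemma runs_halt t t' c c' :
    runs t c c' -> bounded B c' -> step p c' = None -> t <= t' ->
  exec p t' c = Some c' /\ run_bounded p t' B c.
Proof.
move=> + bc' sc'; elim: t t' c => [|t IH] [|t'] c //=.
- by move=> -> _; rewrite sc'.
- by move=> -> _; rewrite sc'.
- by case=> bc [c1 -> r1] lt; have [-> ?] := IH t' _ r1 lt.
Qed.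

Definition code_at (k : nat) (code : program) : Prop :=
  forall j, j < size code -> nth IHalt p (k + j) = nth IHalt code j.

Lemma code_at_cat k c1 c2 :
  code_at k (c1 ++ c2) -> code_at k c1 /\ code_at (k + size c1) c2.
Proof.
move=> H; split=> j Hj.
  by rewrite H ?nth_cat ?Hj // size_cat ltn_addr.
rewrite -addnA H ?size_cat ?ltn_add2l //.
by rewrite nth_cat ltnNge leq_addr /= addKn.
Qed.

Lemma code_at_cons k i c : code_at k (i :: c) ->
  nth IHalt p k = i /\ code_at k.+1 c.
Proof.
move=> H; split; first by rewrite -(addn0 k) H.
by move=> j Hj; rewrite addSnnS H.
Qed.

Lemma runs1 c c' : bounded B c -> step p c = Some c' -> runs 1 c c'.
Proof. by move=> bc sc; split=> //; exists c'. Qed.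

Lemma updE (f : nat -> nat) x v y : upd f x v y = if y == x then v else f y.
Proof. by []. Qed.

Lemma upd_le (f : nat -> nat) x v b :
  (forall y, f y <= b) -> v <= b -> forall y, upd f x v y <= b.
Proof. by move=> fb vb y; rewrite updE; case: ifP. Qed.

Definition agree d (E R : nat -> nat) := forall r, r <= d -> R r = E r.

Lemma agree_upd d E R x v : agree d E R -> d < x -> agree d E (upd R x v).
Proof. by move=> a dx r rd; rewrite updE; case: eqP => [|_]; [lia | apply: a]. Qed.

Section Source.
Variables X : nat.

Lemma binop_correct d t k a b (I : instr) (op : nat -> nat -> nat) E m R v1 v2 :
    (forall R0 k0, nth IHalt p k0 = I ->
       step p (Config k0 R0 m) =
         Some (Config k0.+1 (upd R0 t (op (R0 t) (R0 t.+1))) m)) ->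
    op v1 v2 <= B -> d < t ->
    (forall a0, m a0 <= B) ->
    (forall R k, code_at k (cexp t a) -> agree d E R -> (forall r, R r <= B) ->
       exists R', [/\ runs (size (cexp t a)) (Config k R m)
                      (Config (k + size (cexp t a)) R' m),
         R' t = v1, (forall r, r < t -> R' r = R r) & forall r, R' r <= B]) ->
    (forall R k, code_at k (cexp t.+1 b) -> agree d E R -> (forall r, R r <= B) ->
       exists R', [/\ runs (size (cexp t.+1 b)) (Config k R m)
                      (Config (k + size (cexp t.+1 b)) R' m),
         R' t.+1 = v2, (forall r, r < t.+1 -> R' r = R r) & forall r, R' r <= B]) ->
    agree d E R -> (forall r, R r <= B) ->
    let code := cexp t a ++ cexp t.+1 b ++ [:: I] in
    code_at k code ->
  exists R', [/\ runs (size code) (Config k R m) (Config (k + size code) R' m),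
    R' t = op v1 v2, (forall r, r < t -> R' r = R r) & forall r, R' r <= B].
Proof.
move=> sI opB dt mB IHa IHb aR RB code.
case/code_at_cat=> ca /code_at_cat [cb /code_at_cons [cI _]].
have [R1 [r1 e1 f1 b1]] := IHa R _ ca aR RB.
have aR1 : agree d E R1 by move=> r rd; rewrite f1 ?aR //; lia.
have [R2 [r2 e2 f2 b2]] := IHb R1 _ cb aR1 b1.
exists (upd R2 t (op v1 v2)); split.
- rewrite /code !size_cat /= !addnA.
  apply: runs_trans (runs_trans r1 r2) _.
  rewrite addn1; apply: runs1; first by split.
  by rewrite (sI R2 _ cI) e2 f2 // e1.
- by rewrite updE eqxx.
- by move=> r rt; rewrite updE (ltn_eqF rt) f2 ?f1 //; lia.
- exact: upd_le.
Qed.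

Lemma cexp_correct e d t k E m R :
    d < t -> ewf d e -> (forall r, r <= d -> E r <= X) -> (forall a, m a <= X) ->
    X <= B -> ebound X e <= B ->
    code_at k (cexp t e) -> agree d E R -> (forall r, R r <= B) ->
  exists R', [/\ runs (size (cexp t e)) (Config k R m)
                   (Config (k + size (cexp t e)) R' m),
    R' t = eval E m e, (forall r, r < t -> R' r = R r) & forall r, R' r <= B].
Proof.
move=> + + EX mX XB.
have mB a : m a <= B by apply: leq_trans (mX a) XB.
elim: e t k R => [r|v|a IHa b IHb|a IHa b IHb|a IHa b IHb|a IHa] t k R /=.
- move=> dt rd _ /code_at_cons [c1 /code_at_cons [c2 _]] aR RB.
  exists (upd (upd R t 0) t (upd R t 0 t + upd R t 0 r)).
  have rt : (r == t) = false by lia.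
  have b1 y : upd R t 0 y <= B by apply: upd_le.
  split.
  + split=> //; exists (Config k.+1 (upd R t 0) m); first by rewrite /step /= c1.
    by rewrite addnC; apply: runs1 => //; rewrite /step /= c2.
  + by rewrite !updE !eqxx rt add0n aR.
  + by move=> y yt; rewrite !updE (ltn_eqF yt).
  + by apply: upd_le => //; rewrite !updE !eqxx rt add0n.
- move=> dt _ vB /code_at_cons [c1 _] aR RB.
  exists (upd R t v); split.
  + by rewrite addn1; apply: runs1 => //; rewrite /step /= c1.
  + by rewrite updE eqxx.
  + by move=> y yt; rewrite !updE (ltn_eqF yt).
  + exact: upd_le.
- move=> dt /andP [wa wb] bB cAB aR RB.
  have ha := eval_bound EX mX wa; have hb := eval_bound EX mX wb.
  apply: (binop_correct (d := d) (E := E) (op := addn)) => //; try lia.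
  + by move=> R0 k0 h; rewrite /step /= h.
  + by move=> R0 k0 *; apply: IHa => //; lia.
  + by move=> R0 k0 *; apply: IHb => //; lia.
- move=> dt /andP [wa wb] bB cAB aR RB.
  have ha := eval_bound EX mX wa; have hb := eval_bound EX mX wb.
  apply: (binop_correct (d := d) (E := E) (op := subn)) => //; try lia.
  + by move=> R0 k0 h; rewrite /step /= h.
  + by move=> R0 k0 *; apply: IHa => //; lia.
  + by move=> R0 k0 *; apply: IHb => //; lia.
- move=> dt /andP [wa wb] bB cAB aR RB.
  have ha := eval_bound EX mX wa; have hb := eval_bound EX mX wb.
  have ab := leq_mul ha hb.
  apply: (binop_correct (d := d) (E := E) (op := muln)) => //; try nia.
  + by move=> R0 k0 h; rewrite /step /= h.
  + by move=> R0 k0 *; apply: IHa => //; nia.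
  + by move=> R0 k0 *; apply: IHb => //; nia.
- move=> dt wa bB /code_at_cat [ca /code_at_cons [cl _]] aR RB.
  have [|R1 [r1 e1 f1 b1]] := IHa t k R dt wa _ ca aR RB; first lia.
  exists (upd R1 t (m (eval E m a))); split.
  + rewrite size_cat /= addnA; apply: runs_trans r1 _.
    by rewrite addn1; apply: runs1 => //; rewrite /step /= cl e1.
  + by rewrite updE eqxx.
  + by move=> y yt; rewrite !updE (ltn_eqF yt) f1.
  + exact: upd_le.
Qed.

(** Writes are truncated at E 0 <= [X], so [X] bounds the memory before and after; thus [B] need not
    grow with the number of steps. *)
Lemma ccom_correct c d k E m R :
    wf d c -> (forall r, r <= d -> E r <= X) -> (forall a, m a <= X) ->
    X <= B -> cbound X c <= B ->
    code_at k (ccom d k c) -> agree d E R -> (forall r, R r <= B) ->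
  exists R' t, [/\ runs t (Config k R m)
                     (Config (k + size (ccom d k c)) R' (sem d c E m)),
    t <= cost d c (E 0), agree d E R', (forall r, R' r <= B) &
    forall a, sem d c E m a <= X].
Proof.
move=> + + + XB.
elim: c d k E m R => [a e|a b c IH|c1 IH1 c2 IH2|c IH] d k E m R /=.
- case/andP=> wa we EX mX bB /code_at_cat [ca /code_at_cat [ce cc]] aR RB.
  case/code_at_cons: cc => i1 /code_at_cons [i2 /code_at_cons [i3 _]].
  have [|R1 [r1 e1 f1 b1]] := cexp_correct (ltnSn d) wa EX mX XB _ ca aR RB; first lia.
  have aR1 : agree d E R1 by move=> r rd; rewrite f1 ?aR //; lia.
  have [||R2 [r2 e2 f2 b2]] :=
    cexp_correct (t := d.+2) _ we EX mX XB _ ce aR1 b1; try lia.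
  have aR2 : agree d E R2 by move=> r rd; rewrite f2 ?aR1 //; lia.
  have mB x : m x <= B by apply: leq_trans (mX x) XB.
  set va := eval E m a in e1 *; set ve := eval E m e in e2 *.
  set R3 := upd R2 d.+3 (ve - E 0).
  have veB : ve <= B by rewrite -e2.
  have b3 : forall r, R3 r <= B by apply: upd_le => //; lia.
  set R4 := upd R3 d.+2 (minn ve (E 0)).
  have b4 : forall r, R4 r <= B by apply: upd_le => //; lia.
  exists R4, (size (cexp d.+1 a) + size (cexp d.+2 e) + 3); split=> //.
  + rewrite !size_cat /= !addnA.
    apply: runs_trans (runs_trans r1 r2) _.
    set K := _ + size (cexp d.+2 e) in i1 i2 i3 *.
    split=> //; exists (Config K.+1 R3 m).
      by rewrite /step /= i1 e2 aR2.
    split=> //; exists (Config K.+2 R4 m).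
      rewrite /step /= i2 /R3 !updE eqxx.
      have -> : (d.+2 == d.+3) = false by lia.
      by rewrite e2 -minnE.
    rewrite addn3; apply: runs1 => //.
    rewrite /step /= i3 /R4 /R3 !updE eqxx.
    have -> : (d.+1 == d.+2) = false by lia.
    have -> : (d.+1 == d.+3) = false by lia.
    by rewrite f2 // e1.
  + by do 2![apply: agree_upd; last lia].
  + apply: upd_le => //; have := EX 0 isT; lia.
- case/and3P=> wa wb wc EX mX bB.
  set k1 := k + _ + _.
  case/code_at_cat => ca /code_at_cat [cb] /code_at_cons [i1] /code_at_cons [i2 cc] aR RB.
  have [|R1 [r1 e1 f1 b1]] := cexp_correct (ltnSn d) wa EX mX XB _ ca aR RB; first lia.
  have aR1 : agree d E R1 by move=> r rd; rewrite f1 ?aR //; lia.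
  have [||R2 [r2 e2 f2 b2]] :=
    cexp_correct (t := d.+2) _ wb EX mX XB _ cb aR1 b1; try lia.
  have aR2 : agree d E R2 by move=> r rd; rewrite f2 ?aR1 //; lia.
  have mB x : m x <= B by apply: leq_trans (mX x) XB.
  rewrite -/k1 in i1 i2 cc r2 *.
  have r12 := runs_trans r1 r2.
  rewrite !size_cat /= !addnA -/k1.
  have sJ : step p (Config k1 R2 m) =
      Some (Config (if eval E m a < eval E m b then k1.+2 else k1.+1) R2 m).
    by rewrite /step /= i1 e2 f2 // e1.
  case: ifP sJ => hlt sJ.
    have [|R3 [t [r3 lt3 a3 b3 m3]]] := IH d k1.+2 E m R2 wc EX mX _ cc aR2 b2; first lia.
    exists R3, (size (cexp d.+1 a) + size (cexp d.+2 b) + t.+1); split=> //; last lia.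
    apply: runs_trans r12 _; split=> //; exists (Config k1.+2 R2 m) => //.
    by rewrite !addnS -!addSn.
  exists R2, (size (cexp d.+1 a) + size (cexp d.+2 b) + 2); split=> //; last lia.
  apply: runs_trans r12 _; split=> //; exists (Config k1.+1 R2 m) => //.
  by apply: runs1 => //; rewrite /step /= i2 !addnS !addSn.
- case/andP=> w1 w2 EX mX bB /code_at_cat [cc1 cc2] aR RB.
  have [|R1 [t1 [r1 l1 a1 b1 m1]]] := IH1 d k E m R w1 EX mX _ cc1 aR RB; first lia.
  have [|R2 [t2 [r2 l2 a2 b2 m2]]] := IH2 d _ E _ R1 w2 EX m1 _ cc2 a1 b1; first lia.
  exists R2, (t1 + t2); split=> //; last exact: leq_add.
  by rewrite size_cat addnA; apply: runs_trans r1 r2.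
- move=> wc EX mX bB.
  set body := ccom _ _ _.
  rewrite -cat_cons -cat1s => /code_at_cat [] /code_at_cons [i0 _] /=.
  rewrite addn1 => /code_at_cons [i1 /code_at_cons [i2]].
  move=> /code_at_cat [cb] /code_at_cons [i3] /code_at_cons [i4] /code_at_cons [i5 _].
  have e3 : k.+3 = k + 3 by rewrite addn3.
  rewrite e3 in cb i3 i4 i5.
  move=> aR RB.
  have mB x : m x <= B by apply: leq_trans (mX x) XB.
  have dd y : y <= d -> (y == d.+1) = false by move=> ?; lia.
  set n := E 0.
  have nX : n <= X by apply: EX.
  set f := fun m0 j => sem d.+1 c (upd E d.+1 j) m0.
  (* Invariant at the loop test, with counter j and N iterations left. The 2 pays for the failing
     test and the exit jump, the 4 for the test and the three closing instructions. *)
  have iter_ok N j m0 R0 : N + j = n -> (forall a, m0 a <= X) -> agree d E R0 ->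
      R0 d.+1 = j -> (forall r, R0 r <= B) ->
    exists R' t, [/\ runs t (Config k.+1 R0 m0)
          (Config (k + 6 + size body) R' (foldl f m0 (iota j N))),
      t <= 2 + N * (cost d.+1 c n + 4), agree d E R', (forall r, R' r <= B) &
      forall a, foldl f m0 (iota j N) a <= X].
    elim: N j m0 R0 => [|N IHN] j m0 R0 Nj m0X aR0 R0d R0B /=.
      have m0B x : m0 x <= B by apply: leq_trans (m0X x) XB.
      exists R0, 2; split=> //.
      split=> //; exists (Config k.+2 R0 m0).
        by rewrite /step /= i1 R0d aR0 // -/n -Nj add0n ltnn.
      by apply: runs1 => //; rewrite /step /= i2.
    have m0B x : m0 x <= B by apply: leq_trans (m0X x) XB.
    have [|||R1 [t [r1 l1 a1 b1 m1]]] :=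
        IH d.+1 (k + 3) (upd E d.+1 j) m0 R0 wc _ m0X _ cb _ R0B.
    + by move=> r rd; rewrite updE; case: eqP => [_|?]; [lia | apply: EX; lia].
    + lia.
    + by move=> r rd; rewrite updE; case: eqP => [->//|?]; apply: aR0; lia.
    rewrite -/body in r1; rewrite !updE /= -/n in l1.
    set R2 := upd R1 d.+2 1; set R3 := upd R2 d.+1 j.+1.
    have b2 : forall r, R2 r <= B by apply: upd_le => //; lia.
    have b3 : forall r, R3 r <= B by apply: upd_le => //; lia.
    have a3 : agree d E R3.
      move=> r rd; rewrite /R3 /R2 !updE.
      by case: eqP => [|_]; [lia|]; case: eqP => [|_]; [lia|];
         rewrite a1 ?updE ?dd //; lia.
    have [||R4 [t' [r4 l4 a4 b4 m4]]] := IHN j.+1 _ R3 _ m1 a3 _ b3.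
    + by rewrite -Nj; lia.
    + by rewrite /R3 updE eqxx.
    have m1B x : f m0 j x <= B by apply: leq_trans (m1 x) XB.
    exists R4, (1 + (t + (3 + t'))); split=> //; last by rewrite mulSn; lia.
    apply: (@runs_trans 1 _ _ (Config (k + 3) R0 m0)).
      apply: runs1 => //.
      by rewrite /step /= i1 R0d aR0 // -/n (_ : j < n) //; lia.
    apply: runs_trans r1 _.
    split=> //; exists (Config (k + 3 + size body).+1 R2 (f m0 j)).
      by rewrite /step /= i3.
    split=> //; exists (Config (k + 3 + size body).+2 R3 (f m0 j)).
      rewrite /step /= i4 /R3 /R2 !updE eqxx.
      have -> : (d.+1 == d.+2) = false by lia.
      by rewrite a1 // updE eqxx addn1.
    by split=> //; exists (Config k.+1 R3 (f m0 j)) => //; rewrite /step /= i5.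
  set R1 := upd R d.+1 0.
  have b1 : forall r, R1 r <= B by apply: upd_le.
  have [||R2 [t [r2 l2 a2 b2 m2]]] := iter_ok n 0 m R1 (addn0 n) mX _ _ b1.
  + by apply: agree_upd.
  + by rewrite /R1 updE eqxx.
  have -> : k + (size (body ++ [:: IConst d.+2 1; IAdd d.+1 d.+1 d.+2; IJmp k.+1])).+3
      = k + 6 + size body by rewrite size_cat /=; lia.
  exists R2, t.+1; split=> //.
  by split=> //; exists (Config k.+1 R1 m); first by rewrite /step /= i0.
Qed.

End Source.
End Exec.

(** * Polynomial bounds on time and word size *)

Fixpoint depth (c : com) : nat :=
  match c with
  | Put _ _ => 0
  | When _ _ c => depth c
  | Seq c c' => maxn (depth c) (depth c')
  | Loop c => (depth c).+1
  end.

Lemma cost_poly c d : exists K, forall n, cost d c n <= K * (n + 1) ^ depth c.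
Proof.
elim: c d => [a e|a b c IH|c IH c' IH'|c IH] d /=.
- by exists (size (cexp d.+1 a) + size (cexp d.+2 e) + 3) => n; rewrite muln1.
- have [K HK] := IH d.
  exists (size (cexp d.+1 a) + size (cexp d.+2 b) + 2 + K) => n.
  rewrite mulnDl leq_add // leq_pmulr // expn_gt0; lia.
- have [K HK] := IH d; have [K' HK'] := IH' d.
  exists (K + K') => n; rewrite mulnDl leq_add //.
    by apply: leq_trans (HK n) _; rewrite leq_mul2l leq_pexp2l ?orbT ?leq_maxl //; lia.
  by apply: leq_trans (HK' n) _; rewrite leq_mul2l leq_pexp2l ?orbT ?leq_maxr //; lia.
- have [K HK] := IH d.+1; exists (K + 7) => n.
  rewrite expnS; have := HK n.
  have : 0 < (n + 1) ^ depth c by rewrite expn_gt0; lia.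
  nia.
Qed.

(** The base n + 2 is at least 2 even for n = 0, so a larger exponent absorbs sums and constants. *)
Lemma poly_bound_add (f g : nat -> nat) :
    (exists c, forall n, f n <= (n + 2) ^ c) ->
    (exists c, forall n, g n <= (n + 2) ^ c) ->
  exists c, forall n, f n + g n <= (n + 2) ^ c.
Proof.
move=> [c1 h1] [c2 h2]; exists (c1 + c2).+1 => n.
rewrite expnS expnD; have := h1 n; have := h2 n.
have : 0 < (n + 2) ^ c1 by rewrite expn_gt0; lia.
have : 0 < (n + 2) ^ c2 by rewrite expn_gt0; lia.
nia.
Qed.

Lemma poly_bound_mul (f g : nat -> nat) :
    (exists c, forall n, f n <= (n + 2) ^ c) ->
    (exists c, forall n, g n <= (n + 2) ^ c) ->
  exists c, forall n, f n * g n <= (n + 2) ^ c.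
Proof.
by move=> [c1 h1] [c2 h2]; exists (c1 + c2) => n; rewrite expnD leq_mul.
Qed.

Lemma poly_bound_cst k : exists c, forall n, k <= (n + 2) ^ c.
Proof.
exists k => n; apply: leq_trans (ltnW (ltn_expl k (isT : 1 < 2))) _.
by case: k => [//|k]; rewrite leq_exp2r //; lia.
Qed.

Lemma poly_bound_id : exists c, forall n, n <= (n + 2) ^ c.
Proof. by exists 1 => n; rewrite expn1; lia. Qed.

Lemma ebound_poly s e : exists c, forall n, ebound (n + s) e <= (n + 2) ^ c.
Proof.
have hX := poly_bound_add poly_bound_id (poly_bound_cst s).
elim: e => [r|k|a IHa b IHb|a IHa b IHb|a IHa b IHb|a IHa] //=.
- exact: poly_bound_cst.
- exact: poly_bound_add.
- exact: poly_bound_add.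
- have S f : (exists c, forall n, f n <= (n + 2) ^ c) ->
      exists c, forall n, (f n).+1 <= (n + 2) ^ c.
    move=> hf; have [c hc] := poly_bound_add hf (poly_bound_cst 1).
    by exists c => n; rewrite -addn1.
  exact: poly_bound_mul (S _ IHa) (S _ IHb).
- exact: poly_bound_add.
Qed.

Lemma cbound_poly s c : exists k, forall n, cbound (n + s) c <= (n + 2) ^ k.
Proof.
have hX := poly_bound_add poly_bound_id (poly_bound_cst s).
elim: c => [a e|a b c IH|c IH c' IH'|c IH] /=.
- by apply: poly_bound_add; apply: ebound_poly.
- by apply: poly_bound_add => //; apply: poly_bound_add; apply: ebound_poly.
- exact: poly_bound_add.
- by apply: poly_bound_add => //; apply: poly_bound_add => //; apply: poly_bound_cst.
Qed.

Lemma init_mem_le sigma (u : seq 'I_sigma) a :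
  cmem (init_config u) a <= size u + sigma.
Proof.
rewrite /=; case: ifP => [_|a0]; first lia.
case: ifP => // au.
have lt : a.-1 < size u by lia.
case: u lt {au} => [//|x u] lt.
by rewrite (nth_map x) //; apply: leq_trans (ltnW (ltn_ord _)) (leq_addl _ _).
Qed.

Lemma compile sigma (c : com) : wf 0 c -> depth c <= 2 ->
  exists (p : program) (K : nat), forall u : seq 'I_sigma,
    let n := size u in
    exists fin : config,
      [/\ exec p (K * (n + 1) ^ 2) (init_config u) = Some fin,
          run_bounded p (K * (n + 1) ^ 2) ((n + 2) ^ K) (init_config u) &
          cmem fin = sem 0 c (fun r => if r == 0 then n else 0)
                       (cmem (init_config u))].
Proof.
move=> wc dc.
have [K1 h1] := cost_poly c 0.
have [K2 h2] := poly_bound_add (cbound_poly sigma c)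
  (poly_bound_add poly_bound_id (poly_bound_cst sigma)).
(* Registers start at 0, so this loads cell 0, the input length, into register 0. *)
pose p := ILoad 0 0 :: ccom 0 1 c.
exists p, (K1 + K2 + 1) => u n.
set K := K1 + K2 + 1; set B := (n + 2) ^ K.
have XB : cbound (n + sigma) c + (n + sigma) <= B.
  by apply: leq_trans (h2 n) _; rewrite leq_pexp2l //; lia.
set E := fun r : nat => if r == 0 then n else 0; set m := cmem (init_config u).
have mX a : m a <= n + sigma by apply: init_mem_le.
have mB a : m a <= B by apply: leq_trans (mX a) _; lia.
have aE : agree 0 E (upd (fun _ => 0) 0 n) by move=> [|r].
have [|||||R [t [r l _ bR mX']]] :=
  @ccom_correct p B (n + sigma) c 0 1 E m (upd (fun _ => 0) 0 n) wc _ mX _ _ _ aE.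
- by move=> [|r] // _; rewrite /E /= leq_addr.
- by lia.
- by lia.
- by move=> j jlt.
- by apply: upd_le => //; lia.
set fin := Config _ R _ in r.
have bfin : bounded B fin by split=> //= a; apply: leq_trans (mX' a) _; lia.
have [] := @runs_halt p B t.+1 (K * (n + 1) ^ 2) (init_config u) fin.
- split; first by split=> // a; apply: mB.
  exists (Config 1 (upd (fun _ => 0) 0 n) m) => //.
- exact: bfin.
- by rewrite /step /fin /= add1n nth_default.
- have h : K1 * (n + 1) ^ depth c <= K1 * (n + 1) ^ 2.
    by rewrite leq_mul2l leq_pexp2l ?orbT //; lia.
  have : 0 < (n + 1) ^ 2 by rewrite expn_gt0; lia.
  have := h1 n; rewrite /K; change (E 0) with n in l; nia.
by move=> he hb; exists fin; split.
Qed.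

(** * Combinatorics of seeds *)

Section Seeds.
Variables (T : eqType) (x0 : T).

Lemma occurs_atP (s w : seq T) i :
  reflect (exists A B, w = A ++ s ++ B /\ size A = i) (occurs_at s w i).
Proof.
apply: (iffP andP) => [[le /eqP e]|[A [B [-> <-]]]].
  exists (take i w), (drop (size s) (drop i w)).
  split; last by rewrite size_takel //; lia.
  by rewrite -{1}e !cat_take_drop.
by rewrite !size_cat drop_size_cat // take_size_cat // eqxx; split=> //; lia.
Qed.

Lemma covers_glue (s A B : seq T) :
  covers s (A ++ s) -> covers s (s ++ B) -> covers s (A ++ s ++ B).
Proof.
move=> h1 h2 j jlt.
have [jA|Aj] := ltnP j (size A + size s).
  have [|i /andP [/occurs_atP [A' [B' [e <-]]] ij]] := h1 j; first by rewrite size_cat.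
  exists (size A'); rewrite ij andbT; apply/occurs_atP; exists A', (B' ++ B).
  by rewrite catA e -!catA.
have [|i /andP [/occurs_atP [A' [B' [e ia]]] ij]] := h2 (j - size A).
  by move: jlt; rewrite !size_cat; lia.
exists (size A + i); apply/andP; split; last lia.
by apply/occurs_atP; exists (A ++ A'), B'; rewrite e -catA size_cat ia.
Qed.

(** Occurrences at the multiples of q leave no gap since q <= k; the length q * N + k lets the last
    one end exactly at the right border. *)
Lemma covers_periodic (g : nat -> T) k q N : 0 < q <= k ->
  (forall j, g (j + q) = g j) -> covers (mkseq g k) (mkseq g (q * N + k)).
Proof.
case/andP=> q0 qk gq j; rewrite size_mkseq => jlt.
have gM a l : g (q * a + l) = g l.
  elim: a => [|a IH]; first by rewrite muln0.
  by rewrite mulnS -addnA addnC gq.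
pose a := minn (j %/ q) N.
have aN : a <= N by apply: geq_minr.
exists (q * a); apply/andP; split.
  apply/andP; rewrite !size_mkseq; split; first by nia.
  apply/eqP/(@eq_from_nth _ x0).
    by rewrite size_mkseq size_takel // size_drop size_mkseq; nia.
  move=> l; rewrite size_takel ?size_drop ?size_mkseq; last nia.
  by move=> lk; rewrite nth_take // nth_drop !nth_mkseq ?gM //; nia.
rewrite size_mkseq /a; have := divn_eq j q; have := ltn_pmod j q0.
case: (leqP (j %/ q) N) => h; nia.
Qed.

Lemma mkseq_cat (g : nat -> T) a b :
  mkseq g (a + b) = mkseq g a ++ mkseq (fun j => g (a + j)) b.
Proof.
apply: (@eq_from_nth _ x0); first by rewrite size_cat !size_mkseq.
move=> j; rewrite size_mkseq => jlt; rewrite nth_cat size_mkseq nth_mkseq //.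
by case: ltnP => h; rewrite nth_mkseq ?subnKC //; lia.
Qed.

(** * Common prefixes, periods and reach *)

Fixpoint lcp (s t : seq T) : nat :=
  match s, t with
  | x :: s', y :: t' => if x == y then (lcp s' t').+1 else 0
  | _, _ => 0
  end.

Variable u : seq T.
Local Notation n := (size u).
Local Notation f := (nth x0 u).

Definition ell a b := lcp (drop a u) (drop b u).

Lemma ell_rec a b : ell a b =
  if [&& a < n, b < n & f a == f b] then (ell a.+1 b.+1).+1 else 0.
Proof.
rewrite /ell; case: (ltnP a n) => an /=; last by rewrite drop_oversize.
rewrite (drop_nth x0 an).
case: (ltnP b n) => bn /=; last by rewrite (drop_oversize bn).
by rewrite (drop_nth x0 bn).
Qed.

Lemma ell_nth a b j : j < ell a b -> f (a + j) = f (b + j).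
Proof.
elim: j a b => [|j IH] a b; rewrite ell_rec; case: ifP => // /and3P [_ _ /eqP e] h.
  by rewrite !addn0.
by rewrite -!addSnnS; apply: IH.
Qed.

Lemma ell_le a b : b <= n -> b + ell a b <= n.
Proof.
move=> bn; rewrite /ell.
suff : lcp (drop a u) (drop b u) <= size (drop b u) by rewrite size_drop; lia.
elim: (drop a u) (drop b u) => [|x s IH] [|y t] //=.
by case: ifP => // _; rewrite ltnS.
Qed.

Lemma ell_ge a b k : a + k <= n -> b + k <= n ->
  (forall j, j < k -> f (a + j) = f (b + j)) -> k <= ell a b.
Proof.
elim: k a b => [|k IH] a b // ak bk e; rewrite ell_rec.
have := e 0 isT; rewrite !addn0 => ->.
have [an bn] : a < n /\ b < n by lia.
rewrite an bn eqxx /=; apply: IH; try lia.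
by move=> j jk; rewrite !addSnnS e.
Qed.

(* [reach p k] is the end of the longest factor starting at [p] that has a
   period at most [k], provided that [p + k <= n]. *)
Fixpoint reach p k : nat :=
  if k is k'.+1 then maxn (reach p k') (p + k + ell p (p + k)) else 0.

Lemma leq_reach p k i : 0 < i ->
  i <= reach p k <-> exists q, 0 < q <= k /\ i <= p + q + ell p (p + q).
Proof.
move=> i0; elim: k => [|k [IH1 IH2]] /=.
  by split=> [|[q []]]; lia.
rewrite leq_max; split.
  case/orP => [/IH1 [q [qk iq]]|h]; first by exists q; split=> //; lia.
  by exists k.+1; split=> //; lia.
case=> q [qk iq]; have [e|ne] := eqVneq q k.+1; first by rewrite -e iq orbT.
by rewrite IH2 //; exists q; split=> //; lia.
Qed.

Lemma leq_reach_diag p k : 0 < k -> p + k <= reach p k.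
Proof. by case: k => [|k] //= _; rewrite leq_max -addnA leq_add2l leq_addr orbT. Qed.

Lemma reach_le p k : p + k <= n -> reach p k <= n.
Proof.
elim: k => [|k IH] //= pk; rewrite geq_max IH; last lia.
exact: ell_le.
Qed.

Definition periodic p q i := forall j, p <= j -> j + q < i -> f j = f (j + q).

Lemma reach_periodic p k i : 0 < i <= reach p k ->
  exists2 q, 0 < q <= k & periodic p q i.
Proof.
case/andP=> i0 /(leq_reach _ _ i0) [q [qk iq]]; exists q => // j pj jq.
have := @ell_nth p (p + q) (j - p).
by rewrite addnAC subnKC //; apply; lia.
Qed.

Lemma periodic_reach p k i q : 0 < q <= k -> 0 < i <= n -> periodic p q i ->
  i <= reach p k.
Proof.
move=> qk /andP [i0 iN] per; apply/leq_reach => //; exists q; split=> //.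
have [|pq] := leqP i (p + q); first lia.
suff : i - (p + q) <= ell p (p + q) by lia.
apply: ell_ge; try lia.
by move=> j jlt; rewrite per 1?addnAC //; lia.
Qed.

Lemma periodic_modn p q i l : 0 < q -> periodic p q i -> p + l < i ->
  f (p + l) = f (p + l %% q).
Proof.
move=> q0 per; elim/ltn_ind: l => l IH pl.
have [lq|ql] := ltnP l q; first by rewrite modn_small.
rewrite -{1}(subnK ql) addnA -per; try lia.
by rewrite IH; try lia; rewrite -{2}(subnK ql) modnDr.
Qed.

Definition factor p k := take k (drop p u).

Lemma size_factor p k : p + k <= n -> size (factor p k) = k.
Proof. by move=> pk; rewrite size_takel // size_drop; lia. Qed.

Lemma nth_factor p k l : l < k -> nth x0 (factor p k) l = f (p + l).
Proof. by move=> lk; rewrite nth_take // nth_drop. Qed.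

Lemma factor_mkseq (g : nat -> T) p k : p + k <= n ->
  (forall l, l < k -> f (p + l) = g l) -> factor p k = mkseq g k.
Proof.
move=> pk e; apply: (@eq_from_nth _ x0); first by rewrite size_factor // size_mkseq.
by move=> l; rewrite size_factor // => lk; rewrite nth_factor // nth_mkseq // e.
Qed.

Lemma factor_ell a b k : a + k <= n -> b + k <= n -> k <= ell a b ->
  factor a k = factor b k.
Proof.
move=> ak bk h; apply: (@eq_from_nth _ x0); first by rewrite !size_factor.
move=> l; rewrite size_factor // => lk; rewrite !nth_factor //.
by apply: ell_nth; lia.
Qed.

Lemma take_factor p k i : p + k <= i ->
  take i u = take p u ++ factor p k ++ factor (p + k) (i - (p + k)).
Proof.
move=> pk; rewrite /factor -{1}(subnKC (_ : p <= i)); last lia.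
rewrite takeD; congr (_ ++ _).
rewrite -(subnKC (_ : k <= i - p)); last lia.
by rewrite takeD drop_drop [k + p]addnC; congr (_ ++ take _ _); lia.
Qed.

(* [good k p]: every position up to [p + k] is covered by occurrences of
   [factor p k], the leftmost of which may overhang the left end. *)
Inductive good (k : nat) : nat -> Prop :=
| good_start p : p + k <= reach 0 k -> good k p
| good_next p p' : p' < p <= p' + k -> k <= ell p' p -> good k p' -> good k p.

(** The overhang A arises where the chain starts, by continuing a period q <= k of the prefix to the
    left; later links only glue on an occurrence that overlaps or touches the previous one. *)
Lemma good_covers k p : 0 < k -> p + k <= n -> good k p ->
  exists A, covers (factor p k) (A ++ take p u ++ factor p k).
Proof.
move=> k0 pn gp; elim: gp pn => {p} [p pr|p p' pp' e gp' IH] pn.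
  have [|q qk per] := @reach_periodic 0 k (p + k); first lia.
  have /andP [q0 qk'] := qk.
  pose g j := f ((p + j) %% q).
  have fg l : l < p + k -> f l = f (l %% q).
    by move=> lk; rewrite -[l]add0n (periodic_modn q0 per) // add0n.
  have es : factor p k = mkseq g k.
    by apply: factor_mkseq => // l lk; rewrite fg //; lia.
  (* This length makes the whole word q * p + k long, so the occurrence of the factor at its right
     end is aligned with the period. *)
  exists (mkseq g (q * p - p)); rewrite {1}es.
  have -> : take p u ++ factor p k = mkseq (fun j => g (q * p - p + j)) (p + k).
    rewrite /factor -takeD -(drop0 u).
    apply: factor_mkseq => // l lk.
    rewrite /g add0n fg // (_ : p + _ = p * q + l); last nia.
    by rewrite modnMDl.
  rewrite -mkseq_cat (_ : q * p - p + (p + k) = q * p + k); last nia.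
  by apply: covers_periodic => // j; rewrite /g addnA modnDr.
have pn' : p' + k <= n by lia.
have [A hA] := IH pn'; exists A.
have es := factor_ell pn' pn e.
have -> : A ++ take p u ++ factor p k = A ++ take (p + k) u.
  by rewrite /factor takeD.
rewrite (@take_factor p' k) // ?catA; last lia.
rewrite -!catA -es catA; apply: covers_glue; first by rewrite -catA.
set B := factor (_ + _) _.
have eB : factor p' k ++ B = factor p' (p - p' + k).
  rewrite /B /factor (_ : p - p' + k = k + (p - p')); last lia.
  by rewrite takeD drop_drop [k + p']addnC; congr (_ ++ take _ _); lia.
have eB' : factor p' (p - p' + k) = take (p - p') (drop p' u) ++ factor p' k.
  by rewrite es /factor takeD drop_drop subnK //; lia.
move=> j; rewrite eB size_factor; last lia.
move=> jlt; case: (ltnP j k) => jk.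
  exists 0; apply/andP; split; last by rewrite size_factor //; lia.
  by apply/occurs_atP; exists [::], B.
exists (p - p'); apply/andP; split; last by rewrite size_factor //; lia.
apply/occurs_atP; rewrite eB'; exists (take (p - p') (drop p' u)), [::].
by rewrite cats0 size_takel // size_drop; lia.
Qed.

Lemma good_seed k p i : 0 < k -> p + k <= i <= n -> good k p -> i <= reach p k ->
  seed (factor p k) (take i u).
Proof.
move=> k0 /andP [pi iN] gp ir; split.
  by apply/infixP; exists (take p u), (factor (p + k) (i - (p + k))); apply: take_factor.
have [|A hA] := good_covers k0 _ gp; first lia.
have [|q /andP [q0 qk] per] := @reach_periodic p k i; first lia.
pose g l := f (p + l %% q).
have es : factor p k = mkseq g k.
  by apply: factor_mkseq => [|l lk]; [lia | apply: periodic_modn per _; lia].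
have ei : factor p k ++ factor (p + k) (i - (p + k)) = mkseq g (i - p).
  have -> : factor p k ++ factor (p + k) (i - (p + k)) = factor p (i - p).
    rewrite /factor -(subnKC (_ : k <= i - p)); last lia.
    by rewrite takeD drop_drop [k + p]addnC; congr (_ ++ take _ _); lia.
  by apply: factor_mkseq => [|l lk]; [lia | apply: periodic_modn per _; lia].
(* The period is continued to the right until the part from p on has length q * i + k, the form
   [covers_periodic] asks for. *)
pose B := mkseq (fun j => g (i - p + j)) (q * i + k - (i - p)).
exists (A ++ take i u ++ B); split; last by apply/infixP; exists A, B.
rewrite (take_factor pi) -!catA catA; apply: covers_glue; first by rewrite -catA.
rewrite catA ei -mkseq_cat es subnKC; last nia.
by apply: covers_periodic => [|j]; rewrite ?q0 // /g modnDr.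
Qed.

Lemma seed_id (x : seq T) : seed x x.
Proof.
split; first exact: infix_refl.
exists x; split; last exact: infix_refl.
move=> j jx; exists 0; rewrite add0n jx !andbT.
by apply/occurs_atP; exists [::], [::]; rewrite cats0.
Qed.

(* This is where monotonicity of the seed array enters: a prefix too short to
   contain the factor at [p] either contains an earlier good occurrence of it or
   has a period at most [k], and then its first [k] letters are a seed. *)
Lemma good_prefix_seed k p i : 0 < k -> p + k <= n -> good k p ->
  0 < i <= reach p k -> exists2 s, seed s (take i u) & size s <= k.
Proof.
move=> k0 pn gp; elim: gp pn => {p} [p pr|p p' pp' e gp' IH] pn /andP [i0 ir].
- have iN := leq_trans ir (reach_le pn).
  have [h|h] := leqP (p + k) i.
    exists (factor p k); last by rewrite size_factor.
    by apply: good_seed => //; [lia | apply: good_start].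
  have [ik|ki] := leqP i k.
    by exists (take i u); [apply: seed_id | rewrite size_takel].
  exists (factor 0 k); last by rewrite size_factor //; lia.
  apply: good_seed => //; try lia.
  by apply: good_start; apply: leq_reach_diag.
- have iN := leq_trans ir (reach_le pn).
  have [h|h] := leqP (p + k) i.
    exists (factor p k); last by rewrite size_factor.
    by apply: good_seed => //; [lia | apply: good_next e gp'].
  (* The equal factors at p' and p give u[p'..p+k) the period p - p' <= k, and i < p + k, so i is
     within reach of p'. *)
  apply: IH; first lia.
  rewrite i0; apply/leq_reach => //; exists (p - p').
  by rewrite subnKC; lia.
Qed.

(** * Every seed comes from a good position *)

Section Complete.
Variables (s w A B : seq T) (i : nat).
Hypotheses (i0 : 0 < i <= n) (cw : covers s w) (ew : w = A ++ take i u ++ B).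
Local Notation k := (size s).
Local Notation o := (size A).

Let f_shift j : j < i -> f j = nth x0 w (o + j).
Proof.
move=> ji; rewrite ew nth_cat ltnNge leq_addr /= addKn nth_cat size_takel; last lia.
by rewrite ji nth_take.
Qed.

(* The occurrence of [s] at [c] in [w] starts at the integer c - o relative to
   [u]; it overhangs the left end when c < o. *)
Lemma virtual_occ j : j < i -> exists2 c, c <= o + j < c + k &
  forall l, l < i -> c <= o + l < c + k -> f l = nth x0 s (o + l - c).
Proof.
move=> ji; have [|c /andP [/occurs_atP [C [D [e ec]]] cj]] := @cw (o + j).
  by rewrite ew !size_cat size_takel; lia.
exists c => // l li /andP [cl lk]; rewrite f_shift // e nth_cat ec ltnNge cl /=.
by rewrite nth_cat (_ : o + l - c < k) //; lia.
Qed.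

Lemma seed_size_gt0 : 0 < k.
Proof. by have [|c] := @virtual_occ 0; lia. Qed.

Definition real_occ p := p + k <= i /\ forall l, l < k -> f (p + l) = nth x0 s l.

Lemma real_occ_virtual c : o <= c -> c - o + k <= i ->
    (forall l, l < i -> c <= o + l < c + k -> f l = nth x0 s (o + l - c)) ->
  real_occ (c - o).
Proof.
move=> oc ci h; split=> // l lk; rewrite h; try lia.
by congr nth; lia.
Qed.

Lemma real_occ_ell p p' : real_occ p -> real_occ p' -> k <= ell p p'.
Proof.
move=> [pi hp] [pi' hp']; apply: ell_ge; try lia.
by move=> j jk; rewrite hp // hp'.
Qed.

(** The occurrence covering position p - 1 starts before p, at distance at most k. If it lies inside
    u it is the previous link; if it overhangs on the left, its shift against the one at p is a
    period of u[0..p+k). *)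
Lemma real_occ_good p : real_occ p -> good k p.
Proof.
have k0 := seed_size_gt0.
elim/ltn_ind: p => p IH rp; have [pi hp] := rp.
case: (posnP p) => [->|p0].
  by apply: good_start; apply: leq_reach_diag.
have [|c cj hc] := @virtual_occ p.-1; first lia.
have [oc|co] := leqP o c.
  have rc : real_occ (c - o) by apply: real_occ_virtual hc; lia.
  have h : c - o < p <= c - o + k by lia.
  by apply: good_next h (real_occ_ell rc rp) (IH _ _ rc); lia.
apply: good_start; apply: (@periodic_reach _ _ _ (p + o - c)); try lia.
move=> j _ jlt; rewrite hc; try lia.
have -> : j + (p + o - c) = p + (o + j - c) by lia.
by rewrite hp //; lia.
Qed.

(** The occurrence covering position p + k starts after p, so by maximality of p it overhangs on the
    right; its shift against p, at most k, is a period of u[p..i). *)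
Lemma last_occ_reach p : real_occ p -> (forall p', real_occ p' -> p' <= p) ->
  i <= reach p k.
Proof.
have k0 := seed_size_gt0.
move=> [pi hp] mx.
have [ip|ip] := leqP i (p + k); first exact: leq_trans ip (leq_reach_diag _ k0).
have [c cj hc] := virtual_occ ip.
have ci : i < c - o + k.
  rewrite ltnNge; apply/negP => ci.
  by have := mx _ (real_occ_virtual _ ci hc); lia.
apply: (@periodic_reach _ _ _ (c - o - p)); try lia.
move=> j pj jlt; rewrite [RHS]hc; try lia.
rewrite -{1}(subnKC pj) hp; last lia.
by congr nth; lia.
Qed.

End Complete.

Lemma seed_good s i : 0 < i <= n -> seed s (take i u) ->
  exists p, [/\ 0 < size s, p + size s <= i, good (size s) p & i <= reach p (size s)].
Proof.
move=> i0 [/infixP [C [D eC]] [w [cw /infixP [A [B ew]]]]].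
pose P p := (p + size s <= i) && (factor p (size s) == s).
have PP p : reflect (real_occ s i p) (P p).
  apply: (iffP andP) => [[pi /eqP e]|[pi h]].
    by split=> // l lk; rewrite -(@nth_factor p (size s) l) // e.
  split=> //; apply/eqP/(@eq_from_nth _ x0); first by rewrite size_factor //; lia.
  by move=> l; rewrite size_factor => [lk|]; [rewrite nth_factor // h | lia].
have si : size C + size s <= i.
  have := congr1 size eC; rewrite !size_cat size_takel; lia.
have exP : exists p, P p.
  exists (size C); apply/PP; split=> // l lk.
  rewrite -(@nth_take i); last lia.
  by rewrite eC nth_cat ltnNge leq_addr /= addKn nth_cat lk.
have ubP p : P p -> p <= i by case/andP; lia.
have [p /PP rp mx] := ex_maxnP exP ubP; exists p.
split; first exact: (seed_size_gt0 i0 cw ew); first by case: rp.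
  exact: (real_occ_good i0 cw ew).
by apply: (last_occ_reach i0 cw ew rp) => p' /PP /mx.
Qed.

Definition reached k i := exists k' p,
  [/\ 0 < k' <= k, p + k' <= n, good k' p & i <= reach p k'].

Lemma shortest_seedP i m : 0 < i <= n ->
    reached m i -> (forall m', m' < m -> ~ reached m' i) ->
  shortest_seed_length (take i u) m.
Proof.
move=> i0 rm mn.
have low s : seed s (take i u) -> m <= size s.
  move=> /(seed_good i0) [p [s0 ps gp ir]]; rewrite leqNgt; apply/negP => h.
  by apply: (mn _ h); exists (size s), p; split=> //; lia.
split=> //; have [k [p [km pn gp ir]]] := rm.
have [||||s hs sk] := @good_prefix_seed k p i; try lia; try by [].
by exists s; split=> //; have := low s hs; lia.
Qed.

End Seeds.

(** * The program *)

Local Notation n_ := (Var 0).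
Local Notation "x '[+]' y" := (Plus x y) (at level 50, left associativity).
Local Notation "x '[-]' y" := (Minus x y) (at level 50, left associativity).
Local Notation one := (Cst 1).

(* Memory is split into rows of length n + 1, and row a * 7 + t is row a of table
   t.  Thus row 0 of table 0 is the input, preceded by its length, and row 0 of
   table 1 the output.  The other tables hold [ell] (2), one plus the previous
   occurrence of the factor at p of length k, or 0 (3), [reach] (4), [good] (5),
   and the largest [reach] so far of a good position (6). *)
Definition ecell t a b := Times (Times a (Cst 7) [+] Cst t) (n_ [+] one) [+] b.
Definition eget t a b := Read (ecell t a b).
Definition eput t a b e := Put (ecell t a b) e.

(** The counters are reversed so that the entry at a + 1, b + 1 is ready before the one at a, b; row
    and column n keep their initial 0. Letters are equal iff both truncated differences vanish. *)
Definition lcp_prog : com :=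
  let a := n_ [-] one [-] Var 1 in let b := n_ [-] one [-] Var 2 in
  let ua := eget 0 (Cst 0) (a [+] one) in let ub := eget 0 (Cst 0) (b [+] one) in
  Loop (Loop (When ((ua [-] ub) [+] (ub [-] ua)) one
    (eput 2 a b (eget 2 (a [+] one) (b [+] one) [+] one)))).

(** Overwriting in increasing order of a leaves, for each l, the last a whose common prefix with p
    has length exactly l. Maxima taken downwards in k turn exactly into at least, in linear time per
    p. *)
Definition prev_prog : com :=
  let p := Var 1 in let a := Var 2 in let k := n_ [-] one [-] Var 2 in
  Loop (Seq
    (Loop (When a p (eput 3 p (eget 2 a p) (a [+] one))))
    (Loop (When (eget 3 p k) (eget 3 p (k [+] one))
      (eput 3 p k (eget 3 p (k [+] one)))))).

(** In round k, p increases, so the goodness of an earlier occurrence is known when needed. r + (x -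
    r) is the maximum of r and x. An output cell is written only while it is 0, which keeps the
    least k. *)
Definition seed_prog : com :=
  let k := Var 1 [+] one in let p := Var 2 in let i := Var 2 in
  let r := eget 4 (Var 1) p in let v := eget 3 p k in
  Loop (Seq
    (Loop (When (p [+] k) (n_ [+] one)
      (Seq (eput 4 k p (r [+] (p [+] k [+] eget 2 p (p [+] k) [-] r)))
      (Seq (When (p [+] k) (eget 4 k (Cst 0) [+] one) (eput 5 k p one))
      (Seq (When (Cst 0) v (When (p [+] one) (v [+] k [+] one)
              (When (Cst 0) (eget 5 k (v [-] one)) (eput 5 k p one))))
      (When (Cst 0) (eget 5 k p)
        (When (eget 6 (Cst 0) (Cst 0)) (eget 4 k p)
          (eput 6 (Cst 0) (Cst 0) (eget 4 k p)))))))))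
    (Loop (When i (eget 6 (Cst 0) (Cst 0)) (When (eget 1 (Cst 0) i) one
      (eput 1 (Cst 0) i k))))).

Definition prog : com := Seq lcp_prog (Seq prev_prog seed_prog).

(** * Tables in memory and the meaning of the loop bodies *)

Section Program.
Variable n : nat.
Implicit Types m : nat -> nat.

Definition addr t a b := (a * 7 + t) * (n + 1) + b.
Definition tab m t a b : nat := m (addr t a b).
Definition put m t a b v := upd m (addr t a b) (minn v n).

Lemma tab_put m t a b v t' a' b' :
    t < 7 -> b <= n -> v <= n -> t' < 7 -> b' <= n ->
  tab (put m t a b v) t' a' b' =
  if [&& t' == t, a' == a & b' == b] then v else tab m t' a' b'.
Proof.
move=> t7 bn vn t7' bn'; rewrite /tab /put updE (minn_idPl vn).
congr (if _ then _ else _); apply/eqP/and3P; last first.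
  by case=> /eqP -> /eqP -> /eqP ->.
rewrite /addr => e.
have e1 : a' * 7 + t' = a * 7 + t.
  have := congr1 (divn^~ (n + 1)) e.
  by rewrite !divnMDl ?(divn_small (m := b)) ?(divn_small (m := b')) ?addn0 //; lia.
by split; apply/eqP; nia.
Qed.

Definition loop (f : (nat -> nat) -> nat -> nat -> nat) m := foldl f m (iota 0 n).

Lemma loop_ind (P : nat -> (nat -> nat) -> Prop) f m :
  P 0 m -> (forall j m', j < n -> P j m' -> P j.+1 (f m' j)) -> P n (loop f m).
Proof.
move=> P0 PS; rewrite /loop.
suff H N j m' : N + j = n -> P j m' -> P n (foldl f m' (iota j N)).
  by apply: H => //; rewrite addn0.
elim: N j m' => [|N IH] j m' /=; first by rewrite add0n => ->.
by move=> e Pj; apply: IH; [lia | apply: PS => //; lia].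
Qed.

(* From [lcp_step] to [out_step]: the denotations of the loop bodies of [prog] and
   their parts. *)
Definition lcp_step i m j :=
  let a := n - 1 - i in let b := n - 1 - j in
  let ua := tab m 0 0 (a + 1) in let ub := tab m 0 0 (b + 1) in
  if (ua - ub) + (ub - ua) < 1 then put m 2 a b (tab m 2 (a + 1) (b + 1) + 1)
  else m.

Definition prev_step p m a :=
  if a < p then put m 3 p (tab m 2 a p) (a + 1) else m.

Definition prev_max_step p m j :=
  let k := n - 1 - j in
  if tab m 3 p k < tab m 3 p (k + 1) then put m 3 p k (tab m 3 p (k + 1)) else m.

Definition reach_step k' m p :=
  let k := k' + 1 in let r := tab m 4 k' p in
  put m 4 k p (r + (p + k + tab m 2 p (p + k) - r)).

Definition start_step k m p :=
  if p + k < tab m 4 k 0 + 1 then put m 5 k p 1 else m.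

Definition next_step k m p :=
  let v := tab m 3 p k in
  if 0 < v then if p + 1 < v + k + 1 then if 0 < tab m 5 k (v - 1) then
    put m 5 k p 1 else m else m else m.

Definition max_step k m p :=
  if 0 < tab m 5 k p then
    if tab m 6 0 0 < tab m 4 k p then put m 6 0 0 (tab m 4 k p) else m
  else m.

Definition pos_step k' m p :=
  let k := k' + 1 in
  if p + k < n + 1 then
    max_step k (next_step k (start_step k (reach_step k' m p) p) p) p
  else m.

Definition out_step k' m i :=
  if i < tab m 6 0 0 then
    if tab m 1 0 i < 1 then put m 1 0 i (k' + 1) else m
  else m.

End Program.

Lemma sem_prog E m : let n := E 0 in
  sem 0 prog E m =
  loop n (fun m k' => loop n (out_step n k') (loop n (pos_step n k') m))
   (loop n (fun m p => loop n (prev_max_step n p) (loop n (prev_step n p) m))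
     (loop n (fun m i => loop n (lcp_step n i) m) m)).
Proof. reflexivity. Qed.

(** * Correctness of the program *)

Section Correct.
Variables (sigma : nat) (x0 : 'I_sigma) (u : seq 'I_sigma).
Local Notation n := (size u).
Local Notation f := (nth x0 u).
Local Notation tab := (tab n).
Local Notation put := (put n).
Implicit Types m : nat -> nat.

(* These restatements hide the [eqType] in the type of [u] from [lia]. *)
Let ell_bound a b : b <= n -> b + ell u a b <= n := @ell_le _ u a b.
Let reach_bound p k : p + k <= n -> reach u p k <= n := @reach_le _ u p k.
Let ell_step a b : ell u a b =
  if [&& a < n, b < n & f a == f b] then (ell u a.+1 b.+1).+1 else 0 :=
  @ell_rec _ x0 u a b.
Let ell_common a b k : a + k <= n -> b + k <= n ->
  (forall j, j < k -> f (a + j) = f (b + j)) -> k <= ell u a b :=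
  @ell_ge _ x0 u a b k.

Definition keep (S : pred nat) m m' := forall t a b,
  t < 7 -> S t -> b <= n -> tab m' t a b = tab m t a b.

Lemma keep_trans S m1 m2 m3 : keep S m1 m2 -> keep S m2 m3 -> keep S m1 m3.
Proof. by move=> k1 k2 t a b *; rewrite k2 ?k1. Qed.

Lemma keep_put (S : pred nat) m t a b v :
  t < 7 -> ~~ S t -> b <= n -> v <= n -> keep S m (put m t a b v).
Proof.
move=> t7 St bn vn t' a' b' t7' St' bn'; rewrite tab_put //.
by case: eqP St' => [->|]; rewrite ?(negPf St).
Qed.

(** * Table of common prefixes *)

Definition input m := forall j, j < n -> tab m 0 0 j.+1 = f j.

Lemma lcp_correct m :
    input m -> (forall a b, a <= n -> b <= n -> tab m 2 a b = 0) ->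
  let m' := loop n (fun m i => loop n (lcp_step n i) m) m in
  keep (predC1 2) m m' /\
  forall a b, a <= n -> b <= n -> tab m' 2 a b = ell u a b.
Proof.
move=> inp m0 /=.
have elln a : ell u a n = 0 by rewrite ell_step ltnn andbF.
have elln' b : ell u n b = 0 by rewrite ell_step ltnn.
(* Row n - 1 - i is finished from column n - j on, all rows below it entirely; everything else is
   still 0. *)
pose I i j m' := keep (predC1 2) m m' /\ forall a b, a <= n -> b <= n ->
  tab m' 2 a b =
  if (n - i <= a) || (a == n - 1 - i) && (n - j <= b) then ell u a b else 0.
have [|i m1 iN [k1 h1]|K H] := @loop_ind n (fun i => I i 0)
    (fun m i => loop n (lcp_step n i) m) m.
- split=> // a b an bn; rewrite m0 //.
  case: ifP => // h; have -> // : ell u a b = 0.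
  have [e|e] : a = n \/ b = n by lia.
    by rewrite e elln'.
  by rewrite e elln.
- have [||K H] := @loop_ind n (I i) (lcp_step n i) m1; first by split.
  + move=> j m2 jN [k2 h2].
    rewrite /lcp_step; set a0 := n - 1 - i; set b0 := n - 1 - j.
    have a0E : a0 = n - 1 - i by []. have b0E : b0 = n - 1 - j by [].
    rewrite !addn1 !(k2 0) // ?inp ?h2; try lia.
    have -> : n - i <= a0.+1 by lia.
    have eqE : (f a0 - f b0 + (f b0 - f a0) < 1) = (f a0 == f b0).
      apply/idP/eqP => [h|->]; last by rewrite subnn.
      by apply: val_inj => /=; lia.
    have le : b0 + ell u a0 b0 <= n by apply: ell_bound; lia.
    have := ell_step a0 b0.
    have [-> ->] : a0 < n /\ b0 < n by lia.
    rewrite eqE /=; case: ifP => _ eE.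
      split; first by apply: keep_trans k2 _; apply: keep_put => //; lia.
      move=> a b an bn; rewrite -eE tab_put ?h2 //=; try lia.
      case: andP => [[/eqP -> /eqP ->]|ne]; first by rewrite ifT //; lia.
      congr (if _ then _ else _).
      by apply/idP/idP; move: ne; rewrite a0E b0E; lia.
    split=> // a b an bn; rewrite h2 //.
    have [[-> ->]|ne] : (a = a0 /\ b = b0) \/ ~ (a = a0 /\ b = b0) by lia.
      by rewrite eE !if_same.
    by congr (if _ then _ else _); lia.
  + split=> // a b an bn; rewrite H //.
    have [->|bN] := eqVneq b n; first by rewrite elln !if_same.
    by congr (if _ then _ else _); lia.
split=> // a b an bn; rewrite H // ifT //; lia.
Qed.

(** * Table of previous occurrences *)

Definition prevspec p k v :=
  [/\ v <= p, 0 < v -> k <= ell u v.-1 p & forall a, a < p -> k <= ell u a p -> a < v].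

(* The state of table 3 before its suffix maxima are taken, after the candidates
   below [j] have been entered. *)
Definition prevs0 p j l v :=
  [/\ v <= p, v <= j, 0 < v -> ell u v.-1 p = l &
      forall a, a < p -> a < j -> ell u a p = l -> a < v].

Lemma prev_correct m :
    (forall a b, a <= n -> b <= n -> tab m 2 a b = ell u a b) ->
    (forall a b, a <= n -> b <= n -> tab m 3 a b = 0) ->
  let m' := loop n (fun m p => loop n (prev_max_step n p) (loop n (prev_step n p) m)) m in
  keep (predC1 3) m m' /\
  forall p k, p < n -> k <= n -> prevspec p k (tab m' 3 p k).
Proof.
move=> h2 h3 /=.
pose I p m' := [/\ keep (predC1 3) m m',
  forall p' k, p' < p -> p' < n -> k <= n -> prevspec p' k (tab m' 3 p' k) &
  forall p' k, p <= p' <= n -> k <= n -> tab m' 3 p' k = 0].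
have [|p m1 pN [k1 s1 z1]|K H _] := @loop_ind n I
    (fun m p => loop n (prev_max_step n p) (loop n (prev_step n p) m)) m.
- by split=> // p' k /andP [_ pn]; apply: h3.
- pose I1 j m' := [/\ keep (predC1 3) m1 m',
    forall p' k, p' != p -> k <= n -> tab m' 3 p' k = tab m1 3 p' k &
    forall l, l <= n -> prevs0 p j l (tab m' 3 p l)].
  have [|a m2 aN [k2 o2 s2]|K2 O2 S2] := @loop_ind n I1 (prev_step n p) m1.
  + split=> // l ln; have -> : tab m1 3 p l = 0 by apply: z1; lia.
    by split.
  + rewrite /prev_step; case: ltnP => ap; last first.
      split=> // l ln; have [v1 v2 v3 v4] := s2 l ln; split=> //; first lia.
      by move=> a' a'p a'a; apply: v4 => //; lia.
    have -> : tab m2 2 a p = ell u a p by rewrite k2 ?k1 ?h2 //; lia.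
    have le := @ell_bound a p (ltnW pN).
    split.
    * by apply: keep_trans k2 _; apply: keep_put => //; lia.
    * move=> p' k pp kn; rewrite tab_put; try lia.
      by rewrite (negPf pp) /= o2.
    * move=> l ln; rewrite tab_put; try lia.
      rewrite !eqxx /=; case: eqP => [->|ne].
        by rewrite addn1; split=> //; lia.
      have [v1 v2 v3 v4] := s2 l ln; split=> //; first lia.
      move=> a' a'p a'a e; apply: v4 => //.
      by have [e'|] := eqVneq a' a; [case: ne; rewrite -e -e' | lia].
  (* Columns from n - j on are converted to at least, those before still mean exactly. Column n
     needs no conversion, as no common prefix exceeds n. *)
  pose I2 j m' := [/\ keep (predC1 3) m1 m',
    forall p' k, p' != p -> k <= n -> tab m' 3 p' k = tab m1 3 p' k,
    forall l, n - j <= l <= n -> prevspec p l (tab m' 3 p l) &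
    forall l, l < n - j -> prevs0 p n l (tab m' 3 p l)].
  have [|j m2 jN [k2 o2 s2 r2]|K3 O3 S3 _] :=
      @loop_ind n I2 (prev_max_step n p) (loop n (prev_step n p) m1).
  + split=> // l ln; last by apply: S2; lia.
    have el : l = n by lia.
    have [|v1 v2 v3 v4] := S2 l; first lia.
    split=> // [/v3 ->//|a ap la]; apply: v4 => //; first lia.
    by have := @ell_bound a p (ltnW pN); lia.
  + rewrite /prev_max_step; set k := n - 1 - j.
    have kE : k = n - 1 - j by [].
    have [|v1 v2 v3 v4] := r2 k; first lia.
    have [|w1 w2 w3] := s2 (k + 1); first lia.
    set v := tab m2 3 p k in v1 v2 v3 v4 *.
    set w := tab m2 3 p (k + 1) in w1 w2 w3 *.
    case: ltnP => vw.
      split.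
      * by apply: keep_trans k2 _; apply: keep_put => //; lia.
      * move=> p' l pp ln; rewrite tab_put; try lia.
        by rewrite (negPf pp) /= o2.
      * move=> l ln; rewrite tab_put; try lia.
        rewrite !eqxx /=; case: eqP => [->|ne]; last by apply: s2; lia.
        split=> // [w0|a ap ka]; first by have := w2 w0; lia.
        have [e|e] := eqVneq (ell u a p) k; last by apply: w3 => //; lia.
        by apply: leq_trans vw; apply: leqW; apply: v4 => //; lia.
      * move=> l ln; rewrite tab_put; try lia.
        by rewrite !eqxx /= ifF; [apply: r2 | ]; lia.
    split=> // l ln; last by apply: r2; lia.
    have [->|ne] := eqVneq l k; last by apply: s2; lia.
    split=> // [v0|a ap ka]; first by rewrite v3.
    have [e|e] := eqVneq (ell u a p) k; first by apply: v4 => //; lia.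
    by apply: leq_trans vw; apply: w3 => //; lia.
  split.
  + exact: keep_trans k1 K3.
  + move=> p' k pp p'n kn; have [->|ne] := eqVneq p' p; first by apply: S3; lia.
    by rewrite O3 //; apply: s1 => //; lia.
  + by move=> p' k pp kn; rewrite O3 ?z1 //; lia.
by split=> // p k pn kn; apply: H.
Qed.

(* The nearest previous occurrence is good as soon as any occurrence at distance
   at most [k] is. *)
Lemma good_prevspec p k v : p + k <= n -> prevspec p k v ->
  good u k p <-> p + k <= reach u 0 k \/ [/\ 0 < v, p < v + k & good u k v.-1].
Proof.
move=> pn [vp vk vmax]; split.
  move=> gp; case: gp pn vp vk vmax => {p} [p h|p p' pp' e gp'] pn vp vk vmax.
    by left.
  have [|p'k] := leqP (p + k) (reach u 0 k); first by left.
  right; have pv := vmax p' (proj1 (andP pp')) e.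
  split; try lia.
  have [->//|ne] := eqVneq v.-1 p'.
  (* Here p' < v - 1 < p <= p' + k, so v - 1 is itself linked to p'. *)
  apply: good_next gp'; first lia.
  apply: ell_common; try lia.
  move=> j jk; rewrite (@ell_nth _ x0 u p' p); last lia.
  by rewrite (@ell_nth _ x0 u v.-1 p) //; have := vk (leq_ltn_trans (leq0n _) pv); lia.
case=> [|[v0 pv gv]]; first exact: good_start.
by apply: good_next gv; [lia | apply: vk].
Qed.

(** * Reach, goodness and output *)

Definition maxspec k p M := forall i, i < M <-> exists k' q,
  [/\ 0 < k' <= k, k' < k \/ q < p, q + k' <= n, good u k' q & i < reach u q k'].

Definition tables m :=
  (forall a b, a <= n -> b <= n -> tab m 2 a b = ell u a b) /\
  (forall p k, p < n -> k <= n -> prevspec p k (tab m 3 p k)).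

Lemma tables_keep m m' : keep (fun t => t <= 3) m m' -> tables m -> tables m'.
Proof.
by move=> K [h2 h3]; split=> [a b an bn|p k pn kn]; rewrite K; auto.
Qed.

(** The state in round k before position p. Unvisited cells of table 5 are still 0, so not writing
    one records that the position is not good. *)
Definition pos_inv m0 k p m :=
  [/\ keep (fun t => t <= 3) m0 m,
      forall k' q, k' < k \/ k' = k /\ q < p -> q + k' <= n ->
        tab m 4 k' q = reach u q k',
      forall q, q < p -> q + k <= n -> (0 < tab m 5 k q) <-> good u k q,
      forall k' q, k < k' \/ k' = k /\ p <= q -> q <= n -> tab m 5 k' q = 0 &
      maxspec k p (tab m 6 0 0)].

Lemma maxspec_le k p M : maxspec k p M -> M <= n.
Proof.
case: M => [|M] // /(_ M) [/(_ (ltnSn M)) [k' [q [_ _ qn _ Mr]]] _].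
exact: leq_trans Mr (reach_bound qn).
Qed.

Lemma pos_step_correct m0 k' p m : tables m0 -> k' < n -> p < n ->
  pos_inv m0 k'.+1 p m -> pos_inv m0 k'.+1 p.+1 (pos_step n k' m p).
Proof.
move=> T0 kn pn [K R G Z M].
rewrite /pos_step addn1; set k := k'.+1.
have [h2 h3] := tables_keep K T0.
case: ltnP => pk; last first.
  split=> //.
  - by move=> k1 q kq qn; apply: R => //; lia.
  - by move=> q qp qn; apply: G => //; lia.
  - by move=> k1 q kq qn; apply: Z => //; lia.
  - move=> i; rewrite M; split=> -[k1 [q [k1k kq qn gq ir]]];
      exists k1, q; split=> //; lia.
have {pk} pkn : p + k <= n by lia.
set m1 := reach_step n k' m p.
have E1 : m1 = put m 4 k p (reach u p k).
  rewrite /m1 /reach_step addn1 -/k R; try lia.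
  by rewrite h2; try lia; rewrite /= -/k; congr put; rewrite /maxn; case: ltnP; lia.
have rn := reach_bound pkn.
have T1 t a b : t < 7 -> b <= n -> tab m1 t a b =
    if [&& t == 4, a == k & b == p] then reach u p k else tab m t a b.
  by move=> t7 bn; rewrite E1 tab_put //; lia.
pose g1 := p + k <= reach u 0 k.
set m2 := start_step n k m1 p.
have T2 t a b : t < 7 -> b <= n -> tab m2 t a b =
    if [&& g1, t == 5, a == k & b == p] then 1 else tab m1 t a b.
  move=> t7 bn; rewrite /m2 /start_step.
  (* For p = 0 this entry was written just before, within the same step. *)
  have -> : tab m1 4 k 0 = reach u 0 k.
    by rewrite T1 //= eqxx; case: eqP => [<-//|p0]; apply: R; lia.
  rewrite addn1 ltnS -/g1; case: g1 => //.
  by rewrite tab_put //; lia.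
pose v := tab m 3 p k.
have Hv : prevspec p k v by apply: h3; lia.
have [vp vk vmax] := Hv.
pose g2 := [&& 0 < v, p < v + k & 0 < tab m 5 k v.-1].
set m3 := next_step n k m2 p.
have T3 t a b : t < 7 -> b <= n -> tab m3 t a b =
    if [&& g1 || g2, t == 5, a == k & b == p] then 1 else tab m1 t a b.
  move=> t7 bn; rewrite /m3 /next_step.
  have -> : tab m2 3 p k = v by rewrite T2 //= ?andbF ?T1 //; lia.
  have -> : tab m2 5 k (v - 1) = if g1 && (v.-1 == p) then 1 else tab m 5 k v.-1.
    rewrite subn1 T2 //; last lia.
    by rewrite !eqxx /= T1 //=; lia.
  rewrite !addn1 ltnS.
  have e : 0 < v -> g1 && (v.-1 == p) = false by lia.
  rewrite /g2; case: (ltnP 0 v) => v0; last by rewrite orbF T2.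
  rewrite (e v0); case: (ltnP p (v + k)) => pv /=; last by rewrite orbF T2.
  case: ltnP => _ /=; last by rewrite orbF T2.
  rewrite tab_put //; try lia.
  by rewrite orbT /=; case: ifP => // h; rewrite T2 // h andbF.
have gE : g1 || g2 <-> good u k p.
  rewrite (good_prevspec pkn Hv); split.
    case/orP => [|/and3P [v0 pv gv]]; first by left.
    by right; split=> //; apply/G => //; lia.
  case=> [h|[v0 pv gv]]; apply/orP; first by left.
  by right; apply/and3P; split=> //; apply/G => //; lia.
have m5 : (0 < tab m3 5 k p) = (g1 || g2).
  rewrite T3 //; last lia.
  by rewrite !eqxx !andbT; case: (g1 || g2) => //; rewrite T1 //= ?Z //; lia.
have Mn := maxspec_le M.
set m4 := max_step n k m3 p.
pose M' := if g1 || g2 then maxn (tab m 6 0 0) (reach u p k) else tab m 6 0 0.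
have T4 t a b : t < 7 -> b <= n -> tab m4 t a b =
    if [&& t == 6, a == 0 & b == 0] then M' else tab m3 t a b.
  move=> t7 bn; rewrite /m4 /max_step m5.
  have e6 : tab m3 6 0 0 = tab m 6 0 0 by rewrite T3 //= andbF T1.
  have e4 : tab m3 4 k p = reach u p k by rewrite T3 //= ?andbF ?T1 ?eqxx //; lia.
  have same M0 : M0 = tab m 6 0 0 -> tab m3 t a b =
      if [&& t == 6, a == 0 & b == 0] then M0 else tab m3 t a b.
    by move=> ->; case: ifP => // /and3P [/eqP -> /eqP -> /eqP ->].
  rewrite /M'; case: (g1 || g2); last exact: same.
  rewrite e6 e4; case: ltnP => h; last by apply: same; lia.
  rewrite tab_put // /maxn h //.
split.
- apply: keep_trans K _ => t a b t7 /= t3 bn; rewrite T4 // T3 // T1 //.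
  have [t4 t5 t6] : [/\ t != 4, t != 5 & t != 6] by split; lia.
  by rewrite (negPf t4) (negPf t5) (negPf t6) andbF.
- move=> k1 q kq qn; rewrite T4 /=; try lia.
  rewrite T3 /= ?andbF; try lia.
  rewrite T1 /=; try lia.
  by case: andP => [[/eqP -> /eqP ->]//|ne]; apply: R => //; lia.
- move=> q qp qn; rewrite T4 /=; try lia.
  have [->|ne] := eqVneq q p; first by rewrite m5.
  rewrite T3 /=; try lia.
  by rewrite (negPf ne) !andbF T1 /=; [apply: G | |]; lia.
- move=> k1 q kq qn; rewrite T4 //= T3 // T1 //= Z //; last lia.
  by rewrite ifF //; apply/negP => /and3P [_ /eqP e1 /eqP e2]; lia.
- rewrite T4 // !eqxx /= => i; rewrite /M'.
  have mono : i < tab m 6 0 0 -> exists k1 q,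
      [/\ 0 < k1 <= k, k1 < k \/ q < p.+1, q + k1 <= n, good u k1 q & i < reach u q k1].
    by case/M => k1 [q [k1k kq qn gq ir]]; exists k1, q; split=> //; lia.
  have back k1 q : 0 < k1 <= k -> k1 < k \/ q < p.+1 -> q + k1 <= n ->
      good u k1 q -> i < reach u q k1 ->
      i < tab m 6 0 0 \/ k1 = k /\ q = p.
    move=> k1k kq qn gq ir.
    have [e|ne] : (k1 = k /\ q = p) \/ (k1 < k \/ q < p) by lia.
      by right.
    by left; apply/M; exists k1, q.
  case: (boolP (g1 || g2)) => g; last first.
    split=> // -[k1 [q [k1k kq qn gq ir]]].
    have [//|[e1 e2]] := back k1 q k1k kq qn gq ir.
    by case/negP: g; apply/gE; rewrite -e1 -e2.
  rewrite leq_max; split.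
    case/orP => [/mono //|ir].
    by exists k, p; split=> //; try lia; apply/gE.
  case=> k1 [q [k1k kq qn gq ir]]; apply/orP.
  by have [|[e1 e2]] := back k1 q k1k kq qn gq ir; [left | right; rewrite -e1 -e2].
Qed.

(** Cell i belongs to the prefix of length i + 1. By monotonicity, excluding v - 1 excludes all
    smaller lengths. *)
Definition outspec k i v :=
  v = 0 /\ ~ reached u k i.+1 \/
  [/\ 0 < v <= k, reached u v i.+1 & ~ reached u v.-1 i.+1].

Definition len_inv m0 k m :=
  [/\ keep (fun t => (1 < t) && (t <= 3)) m0 m,
      forall k' q, k' <= k -> q + k' <= n -> tab m 4 k' q = reach u q k',
      forall k' q, k < k' -> q <= n -> tab m 5 k' q = 0,
      forall i, i < tab m 6 0 0 <-> reached u k i.+1 &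
      forall i, i < n -> outspec k i (tab m 1 0 i)].

Lemma reached_mono k k' i : k <= k' -> reached u k i -> reached u k' i.
Proof. by move=> kk [k1 [p [k1k pn gp ir]]]; exists k1, p; split=> //; lia. Qed.

Lemma len_step_correct m0 k' m : tables m0 -> k' < n -> len_inv m0 k' m ->
  len_inv m0 k'.+1 (loop n (out_step n k') (loop n (pos_step n k') m)).
Proof.
move=> T0 kn [K R Z M O].
have Tm : tables m.
  case: T0 => h2 h3.
  by split=> [a b an bn|p k pn kn0]; rewrite K; auto.
set k := k'.+1.
have [|p m1 pn I1|K1 R1 _ Z1 M1] := @loop_ind n (pos_inv m k) (pos_step n k') m.
- split=> //.
  + by move=> k1 q kq qn; apply: R => //; lia.
  + by move=> k1 q kq qn; apply: Z => //; lia.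
  + move=> i; rewrite M; split.
      by case=> k1 [q [k1k qn gq ir]]; exists k1, q; split=> //; lia.
    by case=> k1 [q [k1k kq qn gq ir]]; exists k1, q; split=> //; lia.
- exact: pos_step_correct.
set m1 := loop n (pos_step n k') m in K1 R1 Z1 M1 *.
have M1' i : i < tab m1 6 0 0 <-> reached u k i.+1.
  rewrite M1; split.
    by case=> k1 [q [k1k kq qn gq ir]]; exists k1, q.
  case=> k1 [q [k1k qn gq ir]]; have {}qn : q + k1 <= n := qn.
  exists k1, q; split=> //; lia.
pose I j m' := keep (predC1 1) m1 m' /\ forall i, i < n ->
  if i < j then outspec k i (tab m' 1 0 i) else tab m' 1 0 i = tab m1 1 0 i.
have [|j m2 jn [K2 O2]|K3 O3] := @loop_ind n I (out_step n k') m1.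
- by split.
- rewrite /out_step addn1 -/k.
  have -> : tab m2 6 0 0 = tab m1 6 0 0 by apply: K2.
  have ej : tab m2 1 0 j = tab m 1 0 j.
    by have := O2 j jn; rewrite ltnn => ->; apply: K1 => //; lia.
  rewrite ej.
  have skip : outspec k j (tab m 1 0 j) -> I j.+1 m2.
    move=> o; split=> // i iN; rewrite ltnS leq_eqVlt.
    case: eqP => [->|ne] /=; first by rewrite ej.
    exact: O2.
  have oj := O j jn.
  case: ltnP => jM.
    have rk : reached u k j.+1 by apply/M1'.
    case: oj => [[e0 nr]|[v0 rv nrv]].
      rewrite e0 /=; split.
        by apply: keep_trans K2 _; apply: keep_put => //; lia.
      move=> i iN; rewrite tab_put //=; try lia.
      rewrite ltnS leq_eqVlt; case: eqP => [->|ne] /=; last exact: O2.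
      by rewrite ?eqxx; right; split; rewrite ?ltnSn ?leqnn.
    rewrite ifF; last lia.
    by apply: skip; right; split=> //; lia.
  have nk : ~ reached u k j.+1 by move/M1'; lia.
  apply: skip; case: oj => [[e0 nr]|[v0 rv nrv]]; first by left.
  by case: nk; apply: reached_mono rv; lia.
split.
- move=> t a b t7 t3 bn; rewrite K3 //=; last lia.
  by rewrite K1 //; [apply: K | lia].
- by move=> k1 q kq qn; rewrite K3 //=; [apply: R1 | ]; lia.
- by move=> k1 q kq qn; rewrite K3 //=; apply: Z1 => //; lia.
- by move=> i; rewrite K3.
- by move=> i iN; have := O3 i iN; rewrite iN.
Qed.

Lemma seed_prog_correct m : tables m ->
    (forall t a b, t \in [:: 1; 4; 5; 6] -> b <= n -> tab m t a b = 0) ->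
  forall i, i < n -> shortest_seed_length (take i.+1 u)
    (tab (loop n (fun m k' =>
            loop n (out_step n k') (loop n (pos_step n k') m)) m) 1 0 i).
Proof.
move=> T0 Z0 i iN.
have r0 j : ~ reached u 0 j by case=> k [p []]; lia.
have [|k' m1 kn I1|_ _ _ _ /(_ i iN)] := @loop_ind n (len_inv m)
  (fun m k' => loop n (out_step n k') (loop n (pos_step n k') m)) m.
- split=> //.
  + by move=> k1 q; rewrite leqn0 => /eqP -> qn; rewrite Z0 //; lia.
  + by move=> k1 q _ qn; rewrite Z0.
  + by move=> j; rewrite Z0 //; split=> // /r0.
  + by move=> j jn; left; split=> //; rewrite Z0 //; lia.
- exact: len_step_correct.
set v := tab _ 1 0 i.
case=> [[_ []]|[v0 rv nrv]].
  (* The cell cannot still be 0: u itself, at position 0, is good and reaches every prefix. *)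
  exists n, 0; split=> //; try lia.
    by apply: good_start; apply: leq_reach_diag; lia.
  exact: leq_trans iN (@leq_reach_diag _ u 0 n (leq_ltn_trans (leq0n i) iN)).
apply: (shortest_seedP x0 _ rv); first by rewrite /= iN.
by move=> m' m'v rm'; apply: nrv; apply: reached_mono rm'; lia.
Qed.

Lemma prog_correct i : 0 < i <= n ->
  shortest_seed_length (take i u)
    (sem 0 prog (fun r => if r == 0 then n else 0) (cmem (init_config u)) (n + i)).
Proof.
move=> iN; rewrite sem_prog /=.
set m0 : nat -> nat := fun a => if a == 0 then n else _.
have m0E t a b : 0 < t + a -> tab m0 t a b = 0.
  move=> ta; rewrite /tab /addr /m0.
  (* Outside row 0 of table 0 all addresses exceed n, so these cells start at 0. *)
  have h : n + 1 <= (a * 7 + t) * (n + 1) by apply: leq_pmull; lia.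
  by rewrite !ifF //; lia.
have inp : input m0.
  move=> j jn; rewrite /tab /addr /m0 mul0n add0n /= jn.
  exact: (nth_map x0).
set m1 := loop n _ m0.
have [|K1 h2] := lcp_correct inp; first by move=> *; apply: m0E.
rewrite -/m1 in K1 h2.
have K1' t a b : t < 7 -> t != 2 -> b <= n -> 0 < t -> tab m1 t a b = 0.
  by move=> t7 t2 bn t0; rewrite K1 // m0E //; lia.
set m2 := loop n _ m1.
have [|K2 h3] := prev_correct h2; first by move=> a b an bn; apply: K1'.
rewrite -/m2 in K2 h3.
have T2 : tables m2 by split=> // a b an bn; rewrite K2 ?h2.
have Z2 t a b : t \in [:: 1; 4; 5; 6] -> b <= n -> tab m2 t a b = 0.
  by rewrite !inE => ht bn; rewrite K2 ?K1' //=; lia.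
have := seed_prog_correct T2 Z2 (_ : i.-1 < n).
rewrite {1}/tab /addr (_ : (0 * 7 + 1) * (n + 1) + i.-1 = n + i); last lia.
by rewrite prednK; [apply | ]; lia.
Qed.

End Correct.

(* For every finite alphabet {0,..,sigma-1} there is a word-RAM program and a
   constant c such that, on input u of length n, the program halts within
   c*(n+1)^2 steps, uses only values bounded by (n+2)^c (word size O(log n)),
   and leaves in memory cell n+i the length of the shortest seed of u[1..i],
   for every 1 <= i <= n. *)
Theorem theorem5 (sigma : nat) :
  exists (p : program) (c : nat),
    forall u : seq 'I_sigma,
      let n := size u in
      exists fin : config,
        exec p (c * (n + 1) ^ 2) (init_config u) = Some fin /\
        run_bounded p (c * (n + 1) ^ 2) ((n + 2) ^ c) (init_config u) /\
        (forall i, 1 <= i <= n ->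
           shortest_seed_length (take i u) (cmem fin (n + i))).
Proof.
have [//|//|p [c H]] := @compile sigma prog.
exists p, c => u n; have [fin [h1 h2 h3]] := H u; exists fin; split=> //; split=> //.
move=> i iN; rewrite h3; have {}iN : 0 < i <= size u := iN.
have u0 : 0 < size u by lia.
(* The default letter for [nth] is taken from u, as the alphabet may be empty. *)
have x : 'I_sigma by case: (u) u0 => [|x s _] //.
exact: prog_correct.
Qed.
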